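(* Let $F^h$ be a consistent, monotone, Lipschitz scheme for the PDE $F(x,u(x),\nabla u(x),D^2u(x))=0$, $x\in\bar\Omega$. Suppose also that there exist functions $v,w\in C^2(\bar\Omega)$ such that $v$ is a strict sub-solution and $w$ a strict super-solution of the PDE. Then for sufficiently small $h>0$, the approximation scheme $$F^h(x,u(x),u(x)-u(\cdot))=0,\qquad x\in\mathcal{G}^h,$$ has a solution $u:\mathcal{G}^h\to\mathbb{R}$.
   Context: PDE. $\Omega\subset\mathbb{R}^n$ is a bounded domain, $\mathcal{S}^n$ is the space of symmetric $n\times n$ matrices, and $F:\bar\Omega\times\mathbb{R}\times\mathbb{R}^n\times\mathcal{S}^n\to\mathbb{R}$ (boundary conditions included) is degenerate elliptic: $F(x,u,p,X)\le F(x,v,p,Y)$ whenever $u\le v$ and $X\ge Y$. $F^*$ and $F_*$ denote the upper and lower semi-continuous envelopes of $F$. A function $u\in C^2(\bar\Omega)$ is a strict (classical) sub-solution (super-solution) if there is $\mu>0$ with $F^*(x,u(x),\nabla u(x),D^2u(x))\le-\mu$ (respectively $F_*(x,u(x),\nabla u(x),D^2u(x))\ge\mu$) for every $x\in\bar\Omega$. Schemes. For each small $h>0$, $\mathcal{G}^h\subset\bar\Omega$ is a finite set of discretisation points, with $\lim_{h\to0}\sup_{y\in\Omega}\min_{x\in\mathcal{G}^h}|x-y|=0$. A scheme is a family of maps $F^h$ giving equations $F^h(x,u(x),u(x)-u(\cdot))=0$, $x\in\mathcal{G}^h$, for grid functions $u:\mathcal{G}^h\to\mathbb{R}$; its arguments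 are a grid point, a real number, and a function on $\mathcal{G}^h$. It is - consistent if for any smooth $\phi$ and $x\in\bar\Omega$, $\limsup_{h\to0,\,y\to x,\,z\in\mathcal{G}^h\to x,\,\xi\to0}F^h(z,\phi(y)+\xi,\phi(y)-\phi(\cdot))\le F^*(x,\phi(x),\nabla\phi(x),D^2\phi(x))$ and $\liminf_{h\to0,\,y\to x,\,z\in\mathcal{G}^h\to x,\,\xi\to0}F^h(z,\phi(y)+\xi,\phi(y)-\phi(\cdot))\ge F_*(x,\phi(x),\nabla\phi(x),D^2\phi(x))$ (here ''smooth'' includes $C^2(\bar\Omega)$ functions); - monotone if $F^h$ is a non-decreasing function of its final two arguments; - Lipschitz if $F^h$ is locally Lipschitz continuous in its final two arguments. *)

(* Defs.v *)
From mathcomp Require Export all_boot all_order all_algebra finmap.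
From mathcomp Require Export all_classical all_reals all_analysis.
Export numFieldNormedType.Exports.

Set Implicit Arguments.
Unset Strict Implicit.
Unset Printing Implicit Defensive.
Import Order.TTheory GRing.Theory Num.Theory.
Local Open Scope classical_set_scope.
Local Open Scope ring_scope.

Definition bounded_domain (R : realType) (n : nat) (Omega : set 'rV[R]_n) :=
  [/\ open Omega, connected Omega, Omega !=set0 & bounded_set Omega].

(* The library norm on ['rV[R]_n] is the max norm, hence this definition. It
   induces the same topology, so the max norm is used below wherever only
   neighbourhoods matter. *)
Definition euclidean_norm (R : realType) (n : nat) (x : 'rV[R]_n) : R :=
  Num.sqrt (\sum_i x 0 i ^+ 2).

Section C2_closure.
Context {R : realType} {n : nat}.
Implicit Types (Omega : set 'rV[R]_n) (u g : 'rV[R]_n -> R).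

Definition partial (i : 'I_n) u : 'rV[R]_n -> R :=
  fun x => 'D_(delta_mx 0 i) u x.

Definition extends_continuously Omega g :=
  exists2 g' : 'rV[R]_n -> R,
    {within closure Omega, continuous g'} & forall x, Omega x -> g' x = g x.

(* u is C^2 in Omega and its derivatives of order at most 2 extend
   continuously to the closure of Omega; the values of u outside the closure
   are irrelevant. *)
Definition C2_closure Omega u :=
  [/\ {within closure Omega, continuous u},
      forall i x, Omega x -> derivable u x (delta_mx 0 i),
      forall i, extends_continuously Omega (partial i u),
      forall i j x, Omega x -> derivable (partial i u) x (delta_mx 0 j) &
      forall i j, extends_continuously Omega (partial j (partial i u))].

(* Value at x of the continuous extension of g from Omega to its closure. *)
Definition closure_ext Omega g (x : 'rV[R]_n) : R :=
  lim (g y @[y --> within Omega (nbhs x)]).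

Definition gradient Omega u (x : 'rV[R]_n) : 'rV[R]_n :=
  \row_i closure_ext Omega (partial i u) x.

Definition hessian Omega u (x : 'rV[R]_n) : 'M[R]_n :=
  \matrix_(i, j) closure_ext Omega (partial j (partial i u)) x.

End C2_closure.

Section pde.
Context {R : realType} {n : nat}.
Implicit Types (Omega : set 'rV[R]_n).
Implicit Types (F : 'rV[R]_n -> R -> 'rV[R]_n -> 'M[R]_n -> R).

Definition sym_mx : set 'M[R]_n := [set X | X^T = X].

(* Loewner order on symmetric matrices. *)
Definition loewner_le (X Y : 'M[R]_n) :=
  forall xi : 'rV[R]_n, 0 <= (xi *m (Y - X) *m xi^T) 0 0.

(* F is a total function, but only its values for x in the closure of Omega
   and X symmetric are ever used. *)
Definition degenerate_elliptic Omega F :=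
  forall x u v p X Y, closure Omega x -> sym_mx X -> sym_mx Y ->
    u <= v -> loewner_le Y X -> F x u p X <= F x v p Y.

Definition pde_domain Omega : set ('rV[R]_n * R * 'rV[R]_n * 'M[R]_n) :=
  [set t | closure Omega t.1.1.1 /\ sym_mx t.2].

(* Semicontinuous envelopes, relative to the domain of F; the neighbourhoods
   contain the point itself. They may be infinite, as F need not be locally
   bounded. *)
Definition upper_envelope Omega F (x : 'rV[R]_n) (u : R)
    (p : 'rV[R]_n) (X : 'M[R]_n) : \bar R :=
  limf_esup (fun t : 'rV[R]_n * R * 'rV[R]_n * 'M[R]_n =>
               (F t.1.1.1 t.1.1.2 t.1.2 t.2)%:E)
    (within (pde_domain Omega) (nbhs (x, u, p, X))).

Definition lower_envelope Omega F (x : 'rV[R]_n) (u : R)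
    (p : 'rV[R]_n) (X : 'M[R]_n) : \bar R :=
  limf_einf (fun t : 'rV[R]_n * R * 'rV[R]_n * 'M[R]_n =>
               (F t.1.1.1 t.1.1.2 t.1.2 t.2)%:E)
    (within (pde_domain Omega) (nbhs (x, u, p, X))).

Definition strict_subsolution Omega F (u : 'rV[R]_n -> R) :=
  C2_closure Omega u /\
  exists2 mu : R, 0 < mu & forall x, closure Omega x ->
    (upper_envelope Omega F x (u x) (gradient Omega u x) (hessian Omega u x)
       <= (- mu)%:E)%E.

Definition strict_supersolution Omega F (u : 'rV[R]_n -> R) :=
  C2_closure Omega u /\
  exists2 mu : R, 0 < mu & forall x, closure Omega x ->
    (mu%:E <=
     lower_envelope Omega F x (u x) (gradient Omega u x) (hessian Omega u x))%E.

End pde.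

(* [ereal_inf] of the distances is their minimum when [G h] is nonempty and
   [+oo] when it is empty. *)
Definition discretisation (R : realType) (n : nat) (Omega : set 'rV[R]_n)
    (G : R -> {fset 'rV[R]_n}) :=
  (\forall h \near 0^'+, forall x, x \in G h -> closure Omega x) /\
  (ereal_sup [set ereal_inf [set (euclidean_norm (x - y))%:E
                            | x in [set x | x \in G h]]
             | y in Omega] @[h --> 0^'+] --> 0%E).

(* [S h z a g] is F^h(z, a, g): z is a point of the grid [G h], a a real
   number, and g a function on the grid. *)
Definition scheme (R : realType) (n : nat) (G : R -> {fset 'rV[R]_n}) :=
  forall h : R, G h -> R -> (G h -> R) -> R.

Section scheme_properties.
Context {R : realType} {n : nat}.
Variables (Omega : set 'rV[R]_n) (G : R -> {fset 'rV[R]_n}) (S : scheme G).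

Definition scheme_values (phi : 'rV[R]_n -> R) (x : 'rV[R]_n) (d : R)
    : set (\bar R) :=
  [set r | exists (h : R) (y : 'rV[R]_n) (z : G h) (xi : R),
     [/\ 0 < h < d, closure Omega y /\ `|y - x| < d, `|val z - x| < d,
         `|xi| < d &
         r = (S z (phi y + xi) (fun q : G h => phi y - phi (val q)))%:E]].

(* Upper and lower limits as h -> 0+, y -> x, z -> x with z in G^h, xi -> 0. *)
Definition scheme_limsup phi x : \bar R :=
  ereal_inf [set ereal_sup (scheme_values phi x d) | d in [set d : R | 0 < d]].

Definition scheme_liminf phi x : \bar R :=
  ereal_sup [set ereal_inf (scheme_values phi x d) | d in [set d : R | 0 < d]].

Definition consistent (F : 'rV[R]_n -> R -> 'rV[R]_n -> 'M[R]_n -> R) :=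
  forall phi : 'rV[R]_n -> R, C2_closure Omega phi ->
  forall x, closure Omega x ->
    (scheme_limsup phi x <=
       upper_envelope Omega F x (phi x) (gradient Omega phi x)
         (hessian Omega phi x))%E /\
    (lower_envelope Omega F x (phi x) (gradient Omega phi x)
         (hessian Omega phi x) <= scheme_liminf phi x)%E.

Definition monotone_scheme :=
  \forall h \near 0^'+, forall (z : G h) (a b : R) (f g : G h -> R),
    a <= b -> (forall q, f q <= g q) -> S z a f <= S z b g.

(* Local Lipschitz continuity in (a, g), for the l^1 norm on R x R^(G h); the
   grid is finite, so the choice of norm is immaterial. *)
Definition lipschitz_scheme :=
  \forall h \near 0^'+, forall (z : G h) (a0 : R) (g0 : G h -> R),
    exists d L : R, 0 < d /\
      forall (a b : R) (f g : G h -> R),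
        `|a - a0| < d -> (forall q, `|f q - g0 q| < d) ->
        `|b - a0| < d -> (forall q, `|g q - g0 q| < d) ->
        `|S z a f - S z b g| <= L * (`|a - b| + \sum_q `|f q - g q|).

End scheme_properties.

(* Main.v *)
Require Import Defs.
From mathcomp Require Import lra.

(** The proof has a continuous and a discrete half.

    Consistency compares the scheme with the envelopes of F only pointwise, in
    the limit, but the strict inequalities satisfied by v and w are open
    conditions: around each point of the closure of Omega, the scheme applied to
    v is already negative for every small h and every nearby grid point, and
    likewise positive for w. As the closure of Omega is compact, one threshold
    on h serves all points, so for small h the restrictions of v and w to the
    grid are strict discrete sub- and super-solutions
    ([strict_subsolution_grid], [strict_supersolution_grid]).

    It remains to solve a monotone equation on a fixed finite grid. At a
    maximum of v - w, monotonicity forbids v > w, so v and w are ordered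
    ([residual_comparison]). Perron's method then applies: the supremum u of
    all discrete sub-solutions between v and w is a sub-solution, and if the
    equation were strict at some grid point, u could be raised there, against
    maximality ([perron]). Both steps move the value of u at one grid point a
    little and keep the others fixed; the Lipschitz property enters as
    continuity with respect to such moves ([lipschitz_scheme_continuous]). *)

Set Implicit Arguments.
Unset Strict Implicit.
Unset Printing Implicit Defensive.
Import Order.TTheory GRing.Theory Num.Theory.
Local Open Scope classical_set_scope.
Local Open Scope ring_scope.

(** * Monotone equations on a finite grid *)

Section grid_equation.
Context {R : realType} {I : finType}.
Variable S : I -> R -> (I -> R) -> R.
Implicit Types (u v w f : I -> R) (z : I).

Definition residual u z : R := S z (u z) (fun q => u z - u q).

Hypothesis S_mono : forall z (a b : R) (f g : I -> R),
  a <= b -> (forall q, f q <= g q) -> S z a f <= S z b g.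

(** Where f touches u from above, the differences f z - f q are at most
    u z - u q, while the value itself is the same. In Perron's argument this is
    applied with f = w, where u meets the upper barrier, and with f the raised
    function, at the grid points where it agrees with u. *)
Lemma residual_le_touching u f z :
  (forall q, u q <= f q) -> u z = f z -> residual f z <= residual u z.
Proof.
by move=> uf uz; apply: S_mono => [|q]; rewrite uz// lerB.
Qed.

(** At a maximum z of v - w one has v z - v q >= w z - w q for all q. If
    moreover v z > w z, monotonicity puts the residual of v at z above that of
    w, which contradicts their signs. *)
Lemma residual_comparison v w :
  (forall z, residual v z < 0) -> (forall z, 0 < residual w z) ->
  forall z, v z <= w z.
Proof.
move=> v_sub w_super z0.
case: (@arg_maxP _ _ _ z0 predT (fun q => v q - w q) isT) => z _ zmax.
rewrite leNgt; apply/negP => wv0.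
have wv : w z < v z.
  by rewrite -subr_gt0 (lt_le_trans _ (zmax z0 isT))// subr_gt0.
have : residual w z <= residual v z.
  apply: S_mono => [|q]; first exact: ltW.
  by have := zmax q isT; rewrite /=; lra.
by apply/negP; rewrite -ltNge (lt_trans (v_sub z)).
Qed.

(* Replacing u z by s would keep the entry of the differences at z equal to 0,
   but here it is s - u z. This is at most 0 when s lowers u z and at least 0
   when s raises it, so by monotonicity it only strengthens the estimates that
   Perron's argument takes from continuity. *)
Hypothesis S_cont : forall z u, continuous (fun s => S z s (fun q => s - u q)).

(** The barrier v makes the family of sub-solutions nonempty; the barrier w
    bounds it and leaves room to raise the supremum wherever the residual is
    still negative. *)
Lemma perron v w :
  (forall z, v z <= w z) ->
  (forall z, residual v z <= 0) -> (forall z, 0 <= residual w z) ->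
  exists u, forall z, residual u z = 0.
Proof.
move=> vw v_sub w_super.
pose A := [set f | (forall z, v z <= f z <= w z) /\
                   (forall z, residual f z <= 0)].
pose u z := sup [set f z | f in A].
have Asup z : has_sup [set f z | f in A].
  split; first by exists (v z), v => //; split=> // q; rewrite lexx vw.
  by exists (w z) => _ [f [fvw _] <-]; case/andP: (fvw z).
have Au f : A f -> forall z, f z <= u z.
  by move=> Af z; apply: ub_le_sup; [exact: (Asup z).2|exists f].
have vu z : v z <= u z by apply: Au; split=> // q; rewrite lexx vw.
have uw z : u z <= w z.
  apply: ge_sup; first exact: (Asup z).1.
  by move=> _ [f [fvw _] <-]; case/andP: (fvw z).
(* If the residual of u were positive at z, then by continuity it would remain
   so with u z lowered to the value f z of a nearly maximal sub-solution f; but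
   f <= u, so the residual of f at z is larger still. *)
have u_sub z : residual u z <= 0.
  rewrite leNgt; apply/negP => u_gt0.
  have /nbhs_ballP[d /= d0 dball] := @S_cont z u (u z) _ (lt_nbhsr u_gt0).
  have [_ [f Af <-] ufd] := sup_adherent d0 (Asup z).
  have : 0 < S z (f z) (fun q => f z - u q).
    apply: dball; rewrite /ball/= ger0_norm ?subr_ge0 ?Au//.
    by rewrite ltrBlDr addrC -ltrBlDr.
  apply/negP; rewrite -leNgt (le_trans _ (Af.2 z))//.
  by apply: S_mono => // q; rewrite lerB// Au.
exists u => z; apply/eqP; rewrite eq_le u_sub leNgt /=; apply/negP => u_lt0.
(* Otherwise w touches u from above at z, so the residual of u there is at
   least that of w, hence nonnegative. *)
have uwz : u z < w z.
  rewrite lt_neqAle uw andbT; apply/eqP => uwz.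
  have := le_trans (w_super z) (residual_le_touching uw uwz).
  by rewrite leNgt u_lt0.
have [s [us sw s_lt0]] : exists s, [/\ u z < s, s < w z &
    S z s (fun q => s - u q) < 0].
  near (u z)^'+ => s; exists s; split.
  - by near: s; exact: nbhs_right_gt.
  - by near: s; exact: nbhs_right_lt.
  - near: s; have /cvg_at_right_filter := @S_cont z u (u z).
    by move=> /(_ _ (lt_nbhsl u_lt0)).
(* Raising u at z alone keeps it a sub-solution: at z by the choice of s, and
   elsewhere because f touches u from above. *)
pose f q := if q == z then s else u q.
have fz : f z = s by rewrite /f eqxx.
have uf q : u q <= f q by rewrite /f; case: eqP => // ->; exact: ltW.
suff /Au/(_ z) : A f by rewrite fz leNgt us.
split=> q.
  rewrite (le_trans (vu q) (uf q))/= /f; case: eqP => [->|_]; last exact: uw.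
  exact: ltW.
have [->|qz] := eqVneq q z.
  apply: le_trans (ltW s_lt0); rewrite /residual fz.
  by apply: S_mono => // p; rewrite lerB.
apply: le_trans (u_sub q); apply: residual_le_touching => //.
by rewrite /f (negbTE qz).
Unshelve. all: by end_near. Qed.

End grid_equation.

(** * From the PDE to the grid *)

Lemma lipschitz_scheme_continuous (R : realType) (n : nat)
    (G : R -> {fset 'rV[R]_n}) (S : scheme G) :
  lipschitz_scheme S ->
  \forall h \near 0^'+, forall (z : G h) (u : G h -> R),
    continuous (fun s => S h z s (fun q => s - u q)).
Proof.
apply: filterS => h S_lip z u s0.
have [d [L [d0 dL]]] := S_lip z s0 (fun q => s0 - u q).
(* L * (1 + #|G h|) bounds the Lipschitz constant along the diagonal s; the
   absolute value and the extra 1 only make C positive. *)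
pose C := `|L| * (1 + #|{: G h}|%:R) + 1.
have C0 : 0 < C.
  by rewrite /C ltr_wpDl// mulr_ge0// addr_ge0.
apply/cvgrPdist_lt => e e0.
have near_s0 r : 0 < r -> \forall s \near s0, `|s0 - s| < r.
  by move=> r0; exact: (nbhsx_ballx s0 _ r0).
have eC0 : 0 < e / C by rewrite divr_gt0.
apply: filterS2 (near_s0 _ d0) (near_s0 _ eC0) => s sd se.
have shift q : s0 - u q - (s - u q) = s0 - s by lra.
have gd q : `|s0 - u q - (s0 - u q)| < d by rewrite subrr normr0.
have gsd q : `|s - u q - (s0 - u q)| < d by rewrite distrC shift.
have s0d : `|s0 - s0| < d by rewrite subrr normr0.
have s0sd : `|s - s0| < d by rewrite distrC.
apply: le_lt_trans (dL s0 s _ _ s0d gd s0sd gsd) _.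
under eq_bigr do rewrite shift.
rewrite sumr_const -[X in _ + X]mulr_natl.
rewrite -[X in L * (X + _)]mul1r -mulrDl mulrA.
apply: (@le_lt_trans _ _ ((C - 1) * `|s0 - s|)).
  by rewrite /C addrK ler_wpM2r// ler_wpM2r ?addr_ge0// ler_norm.
have : C * `|s0 - s| < e by rewrite mulrC -ltr_pdivlMr.
by have := normr_ge0 (s0 - s); lra.
Qed.

Section domain_to_grid.
Context {R : realType} {n : nat}.
Implicit Types (Omega K : set 'rV[R]_n).

Lemma compact_closure Omega : bounded_set Omega -> compact (closure Omega).
Proof.
move=> bOmega; apply: bounded_closed_compact; last exact: closed_closure.
have [M0 [M0r M0P]] := bOmega; exists M0; split=> // M M0M x clx.
have OmegaM := M0P _ M0M.
have sub : Omega `<=` closed_ball_ Num.norm 0 M.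
  by move=> y /OmegaM; rewrite /closed_ball_/= sub0r normrN.
have := closed_closed_ball_ (closureS sub clx).
by rewrite /closed_ball_/= sub0r normrN.
Qed.

(** Finitely many of the balls of radius d cover K, and the least of their
    radii is a threshold on h valid for all of K. *)
Lemma compact_near_uniform K (P : R -> 'rV[R]_n -> Prop) :
  compact K ->
  (forall x, K x -> exists2 d : R, 0 < d &
     forall (h : R) z, 0 < h < d -> K z -> `|z - x| < d -> P h z) ->
  \forall h \near 0^'+, forall z, K z -> P h z.
Proof.
move=> /compact_near_coveringP Kc Ploc.
suff : \forall h \near 0^'+, K `<=` (fun z => K z -> P h z).
  by apply: filterS => h KP z Kz; exact: KP.
apply: Kc => x /Ploc[d d0 Pd].
exists (ball x d, [set h | 0 < h < d]) => /=.
  split; first exact: nbhsx_ballx.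
  by near=> h; apply/andP; split.
move=> [z h] /= [xz hd] Kz; apply: Pd => //.
by move: xz; rewrite -ball_normE /= distrC.
Unshelve. all: by end_near. Qed.

Variables (Omega : set 'rV[R]_n) (G : R -> {fset 'rV[R]_n}) (S : scheme G).
Variable F : 'rV[R]_n -> R -> 'rV[R]_n -> 'M[R]_n -> R.
Hypotheses (Omega_bounded : bounded_set Omega)
  (G_closure : \forall h \near 0^'+, forall x, x \in G h -> closure Omega x)
  (S_cons : consistent Omega S F).

(** Taking y = z and xi = 0 in the limits that define consistency turns the
    scheme values into residuals of the restriction of phi to the grid. *)
Lemma scheme_values_diag (phi : 'rV[R]_n -> R) x d h (z : G h) :
  0 < h < d -> closure Omega (val z) -> `|val z - x| < d ->
  scheme_values Omega S phi x d
    (residual (@S h) (phi \o val) z)%:E.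
Proof.
move=> hd Oz zx; exists h, (val z), z, 0; rewrite addr0 normr0; split => //.
by have /andP[h0 /(lt_trans h0)] := hd.
Qed.

Lemma near_grid (P : forall h, G h -> Prop) :
  (forall x, closure Omega x -> exists2 d : R, 0 < d &
     forall h (z : G h), 0 < h < d -> closure Omega (val z) ->
       `|val z - x| < d -> P h z) ->
  \forall h \near 0^'+, forall z : G h, P h z.
Proof.
move=> Ploc.
have Pnear : \forall h \near 0^'+, forall x, closure Omega x ->
    forall z : G h, val z = x -> P h z.
  apply: compact_near_uniform; first exact: compact_closure.
  move=> x Ox; have [d d0 Pd] := Ploc x Ox; exists d => // h y Oy hd yx z zy.
  by apply: Pd; rewrite ?zy.
apply: filterS2 G_closure Pnear => h GO Ph z.
exact: (Ph (val z) (GO _ (valP z))).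
Qed.

(** Consistency bounds the upper limit of the scheme at each x by -mu < 0, so
    some radius d makes all the scheme values within d of x negative. *)
Lemma strict_subsolution_grid v : strict_subsolution Omega F v ->
  \forall h \near 0^'+, forall z : G h, residual (@S h) (v \o val) z < 0.
Proof.
move=> [vC2 [mu mu0 v_sub]]; apply: near_grid => x Ox.
have : (scheme_limsup Omega S v x < 0)%E.
  apply: (le_lt_trans (S_cons vC2 Ox).1).
  by apply: (le_lt_trans (v_sub x Ox)); rewrite lte_fin oppr_lt0.
move=> /ereal_inf_lt[_ [d d0 <-] supd]; exists d => // h z hd Oz zx.
rewrite -lte_fin; apply: le_lt_trans supd.
by apply: ereal_sup_ubound; exact: scheme_values_diag.
Qed.

Lemma strict_supersolution_grid w : strict_supersolution Omega F w ->
  \forall h \near 0^'+, forall z : G h, 0 < residual (@S h) (w \o val) z.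
Proof.
move=> [wC2 [mu mu0 w_super]]; apply: near_grid => x Ox.
have : (0 < scheme_liminf Omega S w x)%E.
  apply: lt_le_trans (S_cons wC2 Ox).2.
  by apply: lt_le_trans (w_super x Ox); rewrite lte_fin.
move=> /ereal_sup_gt[_ [d d0 <-] infd]; exists d => // h z hd Oz zx.
rewrite -lte_fin; apply: (lt_le_trans infd).
by apply: ereal_inf_lbound; exact: scheme_values_diag.
Qed.

End domain_to_grid.

Theorem lemma35 (R : realType) (n : nat) (Omega : set 'rV[R]_n)
    (F : 'rV[R]_n -> R -> 'rV[R]_n -> 'M[R]_n -> R)
    (G : R -> {fset 'rV[R]_n}) (S : scheme G)
    (Omega_dom : bounded_domain Omega)
    (F_ell : degenerate_elliptic Omega F)
    (G_disc : discretisation Omega G)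
    (S_cons : consistent Omega S F)
    (S_mono : monotone_scheme S)
    (S_lip : lipschitz_scheme S)
    (v w : 'rV[R]_n -> R)
    (v_sub : strict_subsolution Omega F v)
    (w_super : strict_supersolution Omega F w) :
  \forall h \near 0^'+, exists u : G h -> R,
    forall x : G h, S h x (u x) (fun y => u x - u y) = 0.
Proof.
have [_ _ _ Omega_bounded] := Omega_dom; have [G_closure _] := G_disc.
have v_grid := strict_subsolution_grid Omega_bounded G_closure S_cons v_sub.
have w_grid := strict_supersolution_grid Omega_bounded G_closure S_cons w_super.
have S_cont := lipschitz_scheme_continuous S_lip.
near=> h.
have mono_h : forall (z : G h) a b (f g : G h -> R),
    a <= b -> (forall q, f q <= g q) -> S h z a f <= S h z b g.
  by near: h.
have vh : forall z : G h, residual (@S h) (v \o val) z < 0 by near: h.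
have wh : forall z : G h, 0 < residual (@S h) (w \o val) z by near: h.
have cont_h : forall (z : G h) (u : G h -> R),
    continuous (fun s => S h z s (fun q => s - u q)) by near: h.
apply: (perron mono_h cont_h (residual_comparison mono_h vh wh)) => z.
- exact/ltW/vh.
- exact/ltW/wh.
Unshelve. all: by end_near. Qed.
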